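(* Let $r\ge 2$ and $m\ge 1$ be integers, and let $SH(m,1,r)$ be the sunflower hypergraph of order $t=r+m-1$, with vertices labelled so that the kernel is $[r-1]$ and the $m$ petals are $\{r\},\{r+1\},\ldots,\{r+m-1\}$. Let $(n_1,\ldots,n_t)$ be a vector of positive integers with $\sum_{i=1}^t n_i=n$. In $\mathcal{B}_n(SH(m,1,r))$, $SH(m,1,r)\circ(n_1,\ldots,n_t)$ attains the minimum spectral radius if and only if $n_i=1$ for each $i\in[r-1]$ and $n_r+n_{r+1}+\cdots+n_{r+(m-1)}=n-r+1$. Moreover: (1) If $n<mr$, then $SH(m,1,r)\circ(n_1,\ldots,n_t)$ attains the maximum spectral radius in $\mathcal{B}_n(SH(m,1,r))$ if and only if $n_i=\lfloor\frac{n-m}{r-1}\rfloor$ or $\lceil\frac{n-m}{r-1}\rceil$ for each $i\in[r-1]$, and $n_j=1$ for each $j\in[t]\setminus[r-1]$. (2) If $n\ge mr$, then $SH(m,1,r)\circ(n_1,\ldots,n_t)$ attains the maximum spectral radius in $\mathcal{B}_n(SH(m,1,r))$ if and only if $SH(m,1,r)\circ(n_1,\ldots,n_t)\cong T_r^r(n)$.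
   Context: An $r$-uniform hypergraph $H$ has a finite vertex set $V(H)$ and an edge set $E(H)$ of $r$-element subsets of $V(H)$; its order is $|V(H)|$. If $V(H)=\{v_1,\ldots,v_n\}$, its adjacency tensor $\mathcal{A}(H)=(a_{i_1\cdots i_r})$ of order $r$ and dimension $n$ has $a_{i_1\cdots i_r}=\frac{1}{(r-1)!}$ if $\{v_{i_1},\ldots,v_{i_r}\}\in E(H)$ and $0$ otherwise. A number $\lambda\in\mathbb{C}$ is an eigenvalue of $\mathcal{A}(H)$ if there is $\mathbf{x}\in\mathbb{C}^n\setminus\{0\}$ with $\sum_{i_2,\ldots,i_r\in[n]}a_{ii_2\cdots i_r}x_{i_2}\cdots x_{i_r}=\lambda x_i^{r-1}$ for all $i\in[n]$. The spectral radius $\rho(H)$ is the maximum of $|\lambda|$ over all eigenvalues $\lambda$ of $\mathcal{A}(H)$. For an $r$-uniform hypergraph $G$ with $V(G)=[t]=\{1,\ldots,t\}$ and a vector $(n_1,\ldots,n_t)$ of positive integers, the blow-up $G\circ(n_1,\ldots,n_t)$ is the $r$-uniform hypergraph whose vertex set is a disjoint union $V_1\cup\cdots\cup V_t$ with $|V_j|=n_j$, and whose edges are exactly the sets $\{u_1,\ldots,u_r\}$ with $u_1\in V_{j_1},\ldots,u_r\in V_{j_r}$ for some $\{j_1,\ldots,j_r\}\in E(G)$. $\mathcal{B}_n(G)$ is the set of all $G\circ(n_1,\ldots,n_t)$ with all $n_i$ positive integers and $\sum_{i=1}^t n_i=n$. For $m>0$ and $0<q<r$, the sunflower hypergraph $SH(m,q,r)$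 has vertex set $X\cup Y_1\cup\cdots\cup Y_m$ (disjoint union), with $|X|=r-q$ (kernel) and $|Y_l|=q$ (petals), and edges $X\cup Y_l$ for $1\le l\le m$. Here $q=1$. $T_r^r(n)$ is the complete $r$-partite $r$-uniform hypergraph of order $n$ with $r$ parts of size $\lfloor n/r\rfloor$ or $\lceil n/r\rceil$: its edges are all $r$-sets containing exactly one vertex from each part. $\cong$ denotes isomorphism of hypergraphs.
   Formalization: For m=1 the ''only if'' of the minimum claim is false as stated (r=2, n=3, (n_1,n_2)=(2,1)); the minimum equivalence is proved literally for m≥2, and for all m≥1 up to an automorphism of SH(m,1,r) relabelling the vector. *)

(* Defs.v *)
From HB Require Import structures.
From mathcomp Require Import classical_sets reals.
From mathcomp Require Import complex.
From mathcomp Require Import all_boot all_order all_algebra perm.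

Set Implicit Arguments.
Unset Strict Implicit.
Unset Printing Implicit Defensive.

Import Order.TTheory GRing.Theory Num.Theory.

Record hypergraph := Hypergraph {
  hvert :> finType;
  hedges : {set {set hvert}}
}.

Definition uniform (r : nat) (H : hypergraph) : Prop :=
  forall e : {set H}, e \in hedges H -> #|e| = r.

Definition hisomorphism (H K : hypergraph) (f : H -> K) : Prop :=
  bijective f /\
  forall e : {set H}, (f @: e \in hedges K) = (e \in hedges H).

Definition hisomorphic (H K : hypergraph) : Prop :=
  exists f : H -> K, hisomorphism f.

Definition automorphism (H : hypergraph) (s : {perm H}) : Prop :=
  hisomorphism (s : H -> H).

Section Spectrum.
Local Open Scope ring_scope.

(* Tensors of order r and dimension #|V|, with indices ranging over V itself
   instead of a numbering of V. *)
Definition adjacency_tensor (R : realType) (r : nat) (H : hypergraph)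
    (s : r.-tuple H) : R[i] :=
  if [set v in s] \in hedges H then ((r.-1)`!)%:R^-1 else 0.

(* The sum over (i_2, ..., i_r) is the sum over the index tuples
   (i_1, ..., i_r) whose first entry i_1 is v. *)
Definition tensor_eigenvalue (R : realType) (r : nat) (V : finType)
    (A : r.-tuple V -> R[i]) (lambda : R[i]) : Prop :=
  exists2 x : {ffun V -> R[i]}, x != 0 &
    forall v : V,
      \sum_(s : r.-tuple V | ohead s == Some v)
         A s * \prod_(u <- behead s) x u
      = lambda * x v ^+ r.-1.

(* A tensor has finitely many eigenvalues, and at least one in positive
   dimension, so that this supremum is a maximum. *)
Definition spectral_radius (R : realType) (r : nat) (H : hypergraph) : R :=
  sup [set ComplexField.Normc.normc lambda | lambda in
        [set lambda : R[i] |
           tensor_eigenvalue (@adjacency_tensor R r H) lambda]]%classic.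

End Spectrum.

Definition blowup_vert (V : finType) (n : V -> nat) : finType :=
  {j : V & 'I_(n j)}.

Definition blowup (r : nat) (G : hypergraph) (n : G -> nat) : hypergraph :=
  Hypergraph [set e : {set blowup_vert n} |
    [exists u : r.-tuple (blowup_vert n),
       (e == [set w in u]) && ([set tag w | w in u] \in hedges G)]].

Definition blowup_class (r N : nat) (G H : hypergraph) : Prop :=
  exists n : G -> nat,
    [/\ forall i, 0 < n i, \sum_i n i = N & H = blowup r n].

Definition attains_min_radius (R : realType) (r N : nat)
    (G H : hypergraph) : Prop :=
  blowup_class r N G H /\
  forall K, blowup_class r N G K ->
    (spectral_radius R r H <= spectral_radius R r K)%R.

Definition attains_max_radius (R : realType) (r N : nat)
    (G H : hypergraph) : Prop :=
  blowup_class r N G H /\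
  forall K, blowup_class r N G K ->
    (spectral_radius R r K <= spectral_radius R r H)%R.

(* SH(m, q, r) on the vertices 0, ..., r - q + m * q - 1: the kernel comes
   first, followed by the m petals, each a block of q consecutive vertices. *)
Definition sunflower_kernel (m q r : nat) : {set 'I_(r - q + m * q)} :=
  [set i : 'I_(r - q + m * q) | i < r - q].

Definition sunflower_petal (m q r : nat) (l : 'I_m) :
    {set 'I_(r - q + m * q)} :=
  [set i : 'I_(r - q + m * q) | r - q + l * q <= i < r - q + l.+1 * q].

Definition sunflower (m q r : nat) : hypergraph :=
  Hypergraph [set sunflower_kernel m q r :|: sunflower_petal q r l | l : 'I_m].

(* T_r^r(N), with the residue classes modulo r of 0, ..., N - 1 as parts. *)
Definition balanced_complete (r N : nat) : hypergraph :=
  Hypergraph [set e : {set 'I_N} |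
    (#|e| == r) && [forall j : 'I_r, #|[set v in e | v %% r == j]| == 1]].

Definition ceil_divn (a b : nat) : nat := (a + b.-1) %/ b.

Lemma blowup_uniform (r : nat) (G : hypergraph) (n : G -> nat) :
  uniform r G -> uniform r (blowup r n).
Proof.
move=> uG e; rewrite inE => /existsP[u /andP[/eqP-> /uG cardG]].
have le_u : #|[set w in u]| <= r.
  by rewrite cardsE (leq_trans (card_size u)) ?size_tuple.
apply/eqP; rewrite eqn_leq le_u /= -{1}cardG.
rewrite (_ : [set tag w | w in u] = [set tag w | w in [set w in u]]).
  exact: leq_imset_card.
by apply/setP=> j; apply/imsetP/imsetP=> -[w wu ->]; exists w; rewrite ?inE // in wu *.
Qed.

Lemma card_ord_itv (k a b : nat) :
  b <= k -> #|[set i : 'I_k | a <= i < b]| = b - a.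
Proof.
move=> lebk; rewrite cardsE -sum1_card.
rewrite -(big_mkord (fun i => a <= i < b) (fun=> 1)).
rewrite -[RHS]muln1 -sum_nat_const_nat (big_nat_widenl a 0) //.
rewrite (big_nat_widen 0 b k) //; exact: eq_bigl.
Qed.

Lemma sunflower_uniform (m q r : nat) :
  q <= r -> uniform r (sunflower m q r).
Proof.
move=> le_qr e /imsetP[l _ ->]; rewrite cardsU.
rewrite (_ : _ :&: _ = set0) ?cards0 ?subn0; last first.
  apply/setP=> i; rewrite !inE; apply/and3P=> -[lt_i le_i _].
  by move: (leq_trans lt_i (leq_trans (leq_addr _ _) le_i)); rewrite ltnn.
rewrite /sunflower_kernel.
have -> : [set i : 'I_(r - q + m * q) | i < r - q]
        = [set i : 'I_(r - q + m * q) | 0 <= i < r - q] by [].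
rewrite !card_ord_itv ?leq_addr ?leq_add2l ?leq_mul2r ?ltn_ord ?orbT //.
by rewrite subn0 subnDl mulSn addnK subnK.
Qed.

(* Main.v *)
(* In a blow-up of SH(m,1,r) all petal vertices play the same role, so it is the
   complete r-partite hypergraph on the r - 1 blown-up kernel vertices and the
   union of the petals.  If the parts have sizes a_i, an eigenvector with part
   sums S_i satisfies prod_(j != i) S_j = lambda x_v^(r-1) on part i, hence
   |lambda| |S_i|^(r-1) <= a_i^(r-1) prod_(j != i) |S_j|; multiplying over i
   gives |lambda|^r <= (prod a_i)^(r-1), and x_v = a_i^(-1/r) attains equality.
   So one has to optimise prod a_i under sum a_i = N, a_i >= 1 and the bound
   m <= a_None on the union of the petals.  The minimum comes from
   prod a_i >= sum a_i - (r - 1).  For the maximum, log x is compared with its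
   chord between x = q and x = q + 1, which is an equality exactly at these two
   integers.  Isomorphisms and automorphisms are handled by noting that any two
   rainbow colourings of a hypergraph give the same spectral radius, hence
   the same product of class sizes. *)

Require Import Defs.
From mathcomp Require Import classical_sets reals complex.
From mathcomp Require Import all_boot all_order all_algebra perm zify ring.

Set Implicit Arguments.
Unset Strict Implicit.
Unset Printing Implicit Defensive.

Import Order.TTheory GRing.Theory Num.Theory.

(** * Complete multipartite hypergraphs as rainbow colourings *)

(** The two cardinality conditions make [c] a bijection from an edge onto [I]: [H] is the complete
    multipartite hypergraph whose parts are the fibres of [c]. *)
Definition rainbow_colouring (I : finType) (H : hypergraph) (c : H -> I) :
    Prop :=
  forall e : {set H},
    (e \in hedges H) = (#|e| == #|I|) && (#|c @: e| == #|I|).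

(** The codomain is only an [eqType], so that multiplicities of part sizes can be counted too, as in
    [class_size (class_size c)]. *)
Definition class_size (T : finType) (I : eqType) (c : T -> I) (i : I) : nat :=
  #|[set v | c v == i]|.

(** * Sums over tuples with distinct colours *)

Section TupleSums.
Local Open Scope ring_scope.

Lemma big_cons_tuple (A : pzSemiRingType) (T : finType) (k : nat)
    (P : pred (k.+1.-tuple T)) (F : k.+1.-tuple T -> A) :
  \sum_(s | P s) F s =
  \sum_(v : T) \sum_(t : k.-tuple T | P [tuple of v :: t])
     F [tuple of v :: t].
Proof.
rewrite pair_big_dep (reindex (fun p : T * k.-tuple T => [tuple of p.1 :: p.2])).
  by [].
exists (fun s => (thead s, [tuple of behead s])) => [[v t] _|s _] /=.
  by congr pair; apply: val_inj.
by rewrite -tuple_eta.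
Qed.

(** Induction on [k]: the head picks a colour [j] of [J], and the tail is rainbow on [J :\ j]. Each
    of the [k.+1] choices of [j] contributes the same product, which builds the factorial. *)
Lemma sum_rainbow_tuples (A : comPzRingType) (T I : finType) (c : T -> I)
    (x : T -> A) (k : nat) (J : {set I}) :
  #|J| = k ->
  \sum_(t : k.-tuple T | uniq (map c t) && all [in J] (map c t))
     \prod_(u <- t) x u =
  k`!%:R * \prod_(i in J) \sum_(v | c v == i) x v.
Proof.
elim: k J => [|k IHk] J cardJ.
  rewrite (cards0_eq cardJ) big_set0 mul1r (big_pred1 [tuple]) ?big_nil //.
  by move=> t; rewrite tuple0 /= eqxx.
rewrite big_cons_tuple /=.
transitivity (\sum_(v | c v \in J)
    x v * (k`!%:R * \prod_(i in J :\ c v) \sum_(w | c w == i) x w)).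
  rewrite [RHS]big_mkcond /=; apply: eq_bigr => v _; case: ifP => Jv; last first.
    by apply: big1 => t; rewrite andbF.
  rewrite -IHk; last by move: cardJ; rewrite (cardsD1 (c v)) Jv => -[].
  rewrite mulr_sumr; apply: eq_big => [t|t _]; last by rewrite big_cons.
  rewrite /= -has_pred1 -all_predC [X in X && _]andbC -andbA -all_predI.
  by congr (_ && _); apply: eq_all => i; rewrite !inE.
rewrite (partition_big c [in J]) //=.
transitivity (\sum_(j in J) k`!%:R * \prod_(i in J) \sum_(w | c w == i) x w).
  apply: eq_bigr => j Jj; rewrite (big_setD1 j Jj) /= mulrCA mulr_suml.
  apply: eq_big => [v|v /andP[_ /eqP->] //].
  by case: eqP => [->|]; rewrite ?Jj ?andbF.
by rewrite sumr_const cardJ -mulrnAl -mulrnA factS mulnC.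
Qed.

End TupleSums.

(** * Ordered edges with a fixed first vertex *)

Section Edges.
Local Open Scope ring_scope.
Variables (H : hypergraph) (I : finType) (c : H -> I).
Hypothesis col : rainbow_colouring c.

Lemma edge_tupleE (s : #|I|.-tuple H) :
  ([set v in s] \in hedges H) = uniq (map c s).
Proof.
have imE : #|c @: [set v in s]| = #|map c s|.
  by apply: eq_card => i; apply/imsetP/mapP => -[v];
     rewrite ?inE => sv ->; exists v; rewrite ?inE.
rewrite col imE cardsE; apply/andP/idP => [[_ /eqP cI]|us].
  by apply/card_uniqP; rewrite cI size_map size_tuple.
split; first by move/map_uniq/card_uniqP: (us) => ->; rewrite size_tuple.
by move/card_uniqP: us => ->; rewrite size_map size_tuple.
Qed.

(** After the head [v], an ordered edge uses every colour other than [c v] exactly once. *)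
Lemma sum_edge_tuples (A : comPzRingType) (x : H -> A) (k : nat) (v : H) :
  #|I| = k.+1 ->
  \sum_(s : k.+1.-tuple H | (ohead s == Some v) && ([set u in s] \in hedges H))
     \prod_(u <- behead s) x u =
  (k`!)%:R * \prod_(i | i != c v) \sum_(u | c u == i) x u.
Proof.
move=> cI; transitivity (\sum_(t : k.-tuple H |
    uniq (map c t) && all [in [set~ c v]] (map c t)) \prod_(u <- t) x u).
  have edgeE (s : k.+1.-tuple H) : ([set u in s] \in hedges H) = uniq (map c s).
    have cI' := cI; move: s; rewrite -cI' => s; exact: edge_tupleE.
  rewrite big_cons_tuple (bigD1 v) //= [X in _ + X]big1 ?addr0; last first.
    by move=> w /negPf wv; apply: big1 => t; rewrite /= /eq_op /= wv.
  apply: eq_bigl => t; rewrite eqxx /= (edgeE [tuple of v :: t]) /=.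
  rewrite andbC -has_pred1 -all_predC; congr (_ && _); apply: eq_all => i.
  by rewrite !inE.
rewrite sum_rainbow_tuples; last by rewrite cardsC1 cI.
by congr (_ * _); apply: eq_bigl => i; rewrite !inE.
Qed.

End Edges.

(** * Spectral radius of a complete multipartite hypergraph *)

Section Radius.
Local Open Scope ring_scope.
Variables (R : realType) (H : hypergraph) (I : finType) (c : H -> I) (k : nat).
Hypotheses (col : rainbow_colouring c) (cardI : #|I| = k.+1) (k_gt0 : (0 < k)%N).
Hypothesis size_gt0 : forall i, (0 < class_size c i)%N.

(** The tensor entry cancels the factorial that counts the orders of the tail, so the left side of
    the eigenvalue equation depends on class sums only. *)
Lemma adjacency_sumE (x : H -> R[i]) (v : H) :
  \sum_(s : k.+1.-tuple H | ohead s == Some v)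
     adjacency_tensor R s * \prod_(u <- behead s) x u =
  \prod_(i | i != c v) \sum_(u | c u == i) x u.
Proof.
have kf : (k`!)%:R != 0 :> R[i] by rewrite pnatr_eq0 -lt0n fact_gt0.
apply: (mulfI kf); rewrite -(sum_edge_tuples col _ _ cardI) mulr_sumr.
rewrite [RHS]big_mkcondr; apply: eq_bigr => s _.
by rewrite /adjacency_tensor; case: ifP; rewrite ?mul0r ?mulr0 // mulVKf.
Qed.

Lemma colour_class_mem (i : I) : exists v, c v = i.
Proof.
have /card_gt0P[v] := size_gt0 i.
by rewrite inE => /eqP; exists v.
Qed.

(** With [z i] a root of order [k.+1] of the size of class [i], the vector equal to [(z i)^-1] on
    class [i] has class sums [z i ^+ k]. *)
Lemma exists_radius_eigenvalue :
  exists2 lam : R[i], tensor_eigenvalue (@adjacency_tensor R k.+1 H) lam &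
    lam ^+ k.+1 = (\prod_i class_size c i)%:R ^+ k.
Proof.
pose z i : R[i] := k.+1.-root (class_size c i)%:R.
have zX i : z i ^+ k.+1 = (class_size c i)%:R by rewrite rootCK.
have z0 i : z i != 0 by rewrite rootC_eq0 // pnatr_eq0 -lt0n.
exists (\prod_i z i ^+ k); last first.
  rewrite prodrXl exprAC natr_prod; congr (_ ^+ _).
  by rewrite -prodrXl; apply: eq_bigr.
exists [ffun v => (z (c v))^-1].
  have [i _] : exists i : I, true by apply/card_gt0P; rewrite cardI.
  have [v _] := colour_class_mem i.
  by apply/eqP => /ffunP/(_ v); rewrite !ffunE => /eqP; rewrite invr_eq0 (negPf (z0 _)).
move=> v; rewrite adjacency_sumE ffunE [in RHS](bigD1 (c v)) //= exprVn mulrAC mulfV.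
  rewrite mul1r; apply: eq_bigr => i _.
  transitivity (\sum_(u | c u == i) (z i)^-1).
    by apply: eq_bigr => u /eqP <-; rewrite ffunE.
  rewrite sumr_const -[#|_|]/#|[pred u | c u == i]|.
  have -> : #|[pred u | c u == i]| = class_size c i by rewrite /class_size cardsE.
  by rewrite -[X in X *+ _]mul1r -mulrnAl -zX exprSr mulfK.
by rewrite expf_neq0.
Qed.

Lemma normr_eigenvalue_bound (lam : R[i]) :
  tensor_eigenvalue (@adjacency_tensor R k.+1 H) lam ->
  `|lam| ^+ k.+1 <= (\prod_i class_size c i)%:R ^+ k.
Proof.
case=> x x_neq0 eigx.
have [->|lam0] := eqVneq lam 0.
  by rewrite normr0 expr0n /= exprn_ge0 ?ler0n.
pose S i := \sum_(u | c u == i) x u.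
have eqS v : \prod_(i | i != c v) S i = lam * x v ^+ k.
  by rewrite -eigx adjacency_sumE.
(* One vanishing class sum forces all the others to vanish, and then x = 0. *)
have S_neq0 i : S i != 0.
  apply/eqP => Si0.
  have x0 v : c v != i -> x v = 0.
    move=> vi; have := eqS v; rewrite (bigD1 i) 1?eq_sym //= Si0 mul0r => /esym/eqP.
    by rewrite mulf_eq0 (negPf lam0) expf_eq0 k_gt0 => /eqP.
  have [j ji] : exists j, j != i.
    have /card_gt0P[j] : (0 < #|[set~ i]|)%N by rewrite cardsC1 cardI.
    by rewrite !inE; exists j.
  have Sj0 : S j = 0 by apply: big1 => u /eqP uj; rewrite x0 ?uj.
  move/eqP: x_neq0; apply; apply/ffunP => v; rewrite ffunE.
  have [vi|/x0//] := eqVneq (c v) i.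
  have := eqS v; rewrite (bigD1 j) ?vi //= Sj0 mul0r => /esym/eqP.
  by rewrite mulf_eq0 (negPf lam0) expf_eq0 k_gt0 => /eqP.
have boundS i :
    `|lam| * `|S i| ^+ k <= (class_size c i)%:R ^+ k * \prod_(j | j != i) `|S j|.
  have [v vi] := colour_class_mem i.
  (* The equation determines [x u ^+ k] from the colour of [u], so the entries of one class have
     equal modulus. *)
  have xE u : c u == i -> `|x u| = `|x v|.
    move=> /eqP ui; apply/eqP; rewrite -(@eqrXn2 _ k) // -!normrX.
    by apply/eqP; congr `|_|; apply: (mulfI lam0); rewrite -!eqS ui vi.
  rewrite -normr_prod -vi eqS vi normrM normrX mulrCA ler_wpM2l // -exprMn.
  apply: lerXn2r; rewrite ?nnegrE ?mulr_ge0 //.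
  apply: le_trans (ler_norm_sum _ _ _) _; rewrite (eq_bigr _ xE).
  by rewrite sumr_const /class_size cardsE mulr_natl.
have prodS : 0 < \prod_i `|S i| by apply: prodr_gt0 => i _; rewrite normr_gt0.
(* Multiplied by this positive factor, the claim is the product over [i] of the bounds [boundS]:
   each [|S j|] occurs on the right for the [k] indices other than [j]. *)
rewrite -(ler_pM2r (exprn_gt0 k prodS)).
have -> : `|lam| ^+ k.+1 * (\prod_i `|S i|) ^+ k =
    \prod_i (`|lam| * `|S i| ^+ k).
  by rewrite big_split /= prodr_const cardI prodrXl.
have -> : (\prod_i class_size c i)%:R ^+ k * (\prod_i `|S i|) ^+ k =
    \prod_i ((class_size c i)%:R ^+ k * \prod_(j | j != i) `|S j|).
  rewrite big_split /= natr_prod -prodrXl; congr (_ * _).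
  rewrite (exchange_big_dep predT) //= -prodrXl; apply: eq_bigr => j _.
  rewrite prodr_const; congr (_ ^+ _).
  rewrite -[LHS]/(k.+1.-1) -cardI -(cardC1 j); apply: eq_card => i.
  by rewrite !inE eq_sym.
by apply: ler_prod => i _; rewrite boundS mulr_ge0 ?exprn_ge0.
Qed.


(** The eigenvalue of [exists_radius_eigenvalue] attains the bound, so the supremum is its modulus.
    Taking the power [k.+1] avoids real roots. *)
Lemma spectral_radiusX :
  0 <= spectral_radius R k.+1 H /\
  spectral_radius R k.+1 H ^+ k.+1 = (\prod_i class_size c i)%:R ^+ k.
Proof.
have [lam eig_lam lamX] := exists_radius_eigenvalue.
pose N := (@ComplexField.Normc.normc R).
have normE (l : R[i]) : `|l| = (N l)%:C%C by [].
have N0 l : 0 <= N l by rewrite -lecR -normE normr_ge0.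
have NX : (N lam)%:C%C ^+ k.+1 = (\prod_i class_size c i)%:R ^+ k.
  by rewrite -normE -normrX lamX normrX normr_nat.
have max_lam l : tensor_eigenvalue (@adjacency_tensor R k.+1 H) l -> N l <= N lam.
  move=> eig_l; rewrite -(@ler_pXn2r _ k.+1) ?nnegrE // -lecR !rmorphXn /= NX.
  by rewrite -normE; exact: normr_eigenvalue_bound.
have radE : spectral_radius R k.+1 H = N lam.
  apply/eqP; rewrite eq_le; apply/andP; split.
    by apply: ge_sup => [|_ [l /max_lam le_l <-]//]; exists (N lam), lam.
  by apply: ub_le_sup; [exists (N lam) => _ [l /max_lam le_l <-]|exists lam].
split; first by rewrite radE.
by apply: complexI; rewrite radE !rmorphXn /= NX rmorph_nat.
Qed.

End Radius.

(** For fixed [r] the radius is an increasing function of the product of the class sizes, so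
    comparing radii becomes comparing products of naturals. *)
Lemma spectral_radius_leE (R : realType) (r : nat) (I J : finType)
    (H K : hypergraph) (c : H -> I) (d : K -> J) :
  1 < r -> #|I| = r -> #|J| = r ->
  rainbow_colouring c -> rainbow_colouring d ->
  (forall i, 0 < class_size c i) -> (forall j, 0 < class_size d j) ->
  (spectral_radius R r H <= spectral_radius R r K)%R =
  (\prod_i class_size c i <= \prod_j class_size d j).
Proof.
case: r => // k; rewrite ltnS => k_gt0 cI cJ colc cold c_gt0 d_gt0.
have [H0 HX] := spectral_radiusX R colc cI k_gt0 c_gt0.
have [K0 KX] := spectral_radiusX R cold cJ k_gt0 d_gt0.
rewrite -(@ler_pXn2r _ k.+1) ?nnegrE // HX KX ler_pXn2r ?nnegrE //.
by rewrite ler_nat.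
Qed.

(** * Transport of colourings and matching of parts *)

Lemma rainbow_colouring_comp (H K : hypergraph) (I : finType) (d : K -> I)
    (f : H -> K) :
  hisomorphism f -> rainbow_colouring d -> rainbow_colouring (d \o f).
Proof.
move=> [/bij_inj f_inj fE] cold e.
by rewrite -fE cold card_imset // imset_comp.
Qed.

Lemma class_size_comp (T U : finType) (I : eqType) (d : U -> I) (f : T -> U) (i : I) :
  bijective f -> class_size (d \o f) i = class_size d i.
Proof.
move=> f_bij; rewrite /class_size -(card_imset _ (bij_inj f_bij)).
case: f_bij => g fK gK; apply: eq_card => u; rewrite !inE.
apply/imsetP/idP => [[v]|du]; first by rewrite inE => + ->.
by exists (g u); rewrite ?inE /= gK.
Qed.

(** Within each colour, an element of [T] goes to the element of [U] at the same position in the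
    enumeration of its class. *)
Lemma class_size_le_inj (T U : finType) (I : eqType) (c : T -> I) (d : U -> I) :
  (forall i, class_size c i <= class_size d i) ->
  exists2 f : T -> U, injective f & forall v, d (f v) = c v.
Proof.
move=> le_size.
pose C v := [set w | c w == c v]; pose D v := [set u | d u == c v].
have Cv v : v \in enum (C v) by rewrite mem_enum inE.
have ltD v : index v (enum (C v)) < size (enum (D v)).
  by rewrite -cardE (leq_trans _ (le_size (c v))) // /class_size cardE index_mem.
(* [nth] needs a default element of [U]; if [U] is empty, so is [T]. *)
have [u0|U0] := pickP (@predT U); last first.
  have T0 (v : T) : False.
    by have := ltD v; rewrite -cardE eq_card0 // => u; have := U0 u.
  by exists (fun v => False_rect U (T0 v)) => v; case: (T0 v).
move=> _; pose f v := nth u0 (enum (D v)) (index v (enum (C v))).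
have fE v : d (f v) = c v.
  by have := mem_nth u0 (ltD v); rewrite mem_enum inE => /eqP.
exists f => // v w eq_f; have eq_c : c v = c w by rewrite -!fE eq_f.
have eqC : C v = C w by rewrite /C eq_c.
have eqD : D v = D w by rewrite /D eq_c.
have := ltD v; move: eq_f; rewrite /f eqC eqD => /eqP + lt_v.
rewrite nth_uniq ?enum_uniq ?ltD // => /eqP.
by apply: index_inj => //; rewrite -eqC; exact: Cv.
Qed.

Lemma class_size_eq_bij (T U : finType) (I : eqType) (c : T -> I) (d : U -> I) :
  class_size c =1 class_size d ->
  exists2 f : T -> U, bijective f & forall v, d (f v) = c v.
Proof.
move=> eq_size.
have [|f f_inj fE] := @class_size_le_inj T U I c d.
  by move=> i; rewrite eq_size.
have [|g g_inj _] := @class_size_le_inj U T I d c.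
  by move=> i; rewrite eq_size.
by exists f => //; apply: inj_card_bij (leq_card g g_inj).
Qed.

(** The multiset of part sizes determines the hypergraph: [s] matches parts of equal size, then [f]
    matches vertices inside matched parts. *)
Lemma hisomorphic_rainbow (H K : hypergraph) (I J : finType) (c : H -> I)
    (d : K -> J) :
  rainbow_colouring c -> rainbow_colouring d -> 
  class_size (class_size c) =1 class_size (class_size d) ->
  hisomorphic H K.
Proof.
move=> colc cold eq_size.
have [s s_bij sE] := class_size_eq_bij eq_size.
have [|f f_bij fE] := @class_size_eq_bij H K J (s \o c) d.
  move=> j; case: s_bij (s_bij) => t sK tK s_bij.
  rewrite -(tK j) sE; rewrite /class_size; apply: eq_card => v; rewrite !inE /=.
  by rewrite (inj_eq (bij_inj s_bij)).
have cIJ := bij_eq_card s_bij.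
exists f; split=> // e; rewrite colc cold card_imset ?cIJ; last exact: bij_inj.
congr (_ && (_ == _)); rewrite -(card_imset (c @: e) (bij_inj s_bij)).
rewrite -!imset_comp (@eq_imset _ _ (d \o f) (s \o c)) //.
Qed.

(** * Colourings of blow-ups *)

Lemma class_size_blowup (r : nat) (G : hypergraph) (n : G -> nat)
    (I : finType) (d : G -> I) (k : I) :
  class_size (fun w : blowup r n => d (tag w)) k = \sum_(i | d i == k) n i.
Proof.
rewrite /class_size -sum1_card.
transitivity (\sum_(i | d i == k) \sum_(x < n i) 1); last first.
  by apply: eq_bigr => i _; rewrite sum1_card card_ord.
rewrite sig_big_dep /=; apply: eq_bigl => w.
by rewrite !inE andbT.
Qed.

(** An edge of [G] has [r] elements, so an [r]-tuple projecting onto it has no repetition;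
    conversely [r] vertices with distinct colours have distinct tags. *)
Lemma rainbow_blowup (r : nat) (G : hypergraph) (n : G -> nat)
    (I : finType) (d : G -> I) :
  #|I| = r -> rainbow_colouring d ->
  rainbow_colouring (fun w : blowup r n => d (tag w)).
Proof.
move=> cI cold e; rewrite inE cI.
have imE (B : {set blowup_vert n}) :
    (fun w : blowup r n => d (tag w)) @: B = d @: (tag @: B).
  by rewrite -imset_comp.
have tagE (u : r.-tuple (blowup_vert n)) :
    [set tag w | w in u] = tag @: [set w in u].
  by apply/setP=> j; apply/imsetP/imsetP=> -[w wu ->]; exists w; rewrite ?inE // in wu *.
rewrite imE; apply/existsP/andP => [[u /andP[/eqP -> ]]|[/eqP ce /eqP de]].
  rewrite tagE cold cI => /andP[/eqP ct ->]; split=> //.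
  have := leq_imset_card tag [in [set w in u]]; rewrite ct => ge_u.
  by rewrite eqn_leq ge_u cardsE (leq_trans (card_size u)) ?size_tuple.
have se : size (enum e) == r by rewrite -cardE ce.
have eE : [set w in Tuple se] = e by apply/setP => w; rewrite inE mem_enum.
exists (Tuple se); rewrite tagE eE eqxx cold cI de eqxx andbT /=.
have le_r := leq_imset_card tag [in e]; rewrite ce in le_r.
by rewrite eqn_leq le_r -de leq_imset_card.
Qed.

(* All petal vertices share the colour None. *)
Definition sunflower_colour (m r : nat) (i : sunflower m 1 r) :
    option 'I_(r - 1) :=
  insub (nat_of_ord (i : 'I_(r - 1 + m * 1))).

(** * Part sizes of blow-ups of the sunflower *)

Section Sunflower.
Variables (m r : nat).
Hypotheses (m_gt0 : 0 < m) (r_gt0 : 0 < r).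
Notation colour := (@sunflower_colour m r).
Notation kernel := (sunflower_kernel m 1 r).

Lemma card_sunflower_colour : #|{: option 'I_(r - 1)}| = r.
Proof. by rewrite card_option card_ord subn1 prednK. Qed.

Lemma sunflower_colour_kernel (i : sunflower m 1 r) (j : 'I_(r - 1)) :
  (colour i == Some j) = (i == lshift (m * 1) j).
Proof.
rewrite /sunflower_colour; case: insubP => [u _ ui|ge_i] /=.
  by apply/eqP/eqP => [[<-]|eq_i]; [apply: val_inj|congr Some; apply: val_inj];
     rewrite /= ui ?eq_i.
by apply/esym/negbTE; apply: contra ge_i => /eqP ->; rewrite /= ltn_ord.
Qed.

Lemma sunflower_colour_petal (i : sunflower m 1 r) :
  (colour i == None) = (i \notin kernel).
Proof. by rewrite /sunflower_colour inE; case: insubP => [u ->|/negPf ->]. Qed.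

(** Each kernel colour has a single vertex, so a transversal contains the whole kernel, and its
    remaining vertex is one petal. *)
Lemma rainbow_sunflower : rainbow_colouring colour.
Proof.
move=> e; rewrite card_sunflower_colour.
have petalE (l : 'I_m) (i : sunflower m 1 r) :
    (i \in sunflower_petal 1 r l) = (i == r - 1 + l :> nat).
  by rewrite inE; apply/idP/eqP; lia.
apply/idP/andP => [e_edge|[/eqP card_e /eqP card_ce]].
  split; first by apply/eqP; apply: (@sunflower_uniform m 1 r).
  case/imsetP: e_edge => l _ ->.
  suff -> : colour @: (kernel :|: sunflower_petal 1 r l) = setT.
    by rewrite cardsT card_sunflower_colour.
  apply/setP => -[j|]; rewrite [RHS]inE; apply/imsetP.
    exists (lshift (m * 1) j); last by apply/esym/eqP; rewrite sunflower_colour_kernel.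
    by rewrite !inE /= ltn_ord.
  have lt_l : l < m * 1 by rewrite muln1.
  exists (rshift (r - 1) (Ordinal lt_l)); first by rewrite in_setU petalE eqxx orbT.
  by apply/esym/eqP; rewrite sunflower_colour_petal inE /= -leqNgt leq_addr.
have ceT : colour @: e = setT.
  by apply/eqP; rewrite eqEcard subsetT cardsT card_sunflower_colour card_ce /=.
have /imsetP[i e_i /esym/eqP] : None \in colour @: e by rewrite ceT.
rewrite sunflower_colour_petal inE -leqNgt => ge_i.
have lt_i : i - (r - 1) < m.
  by have := ltn_ord (i : 'I_(r - 1 + m * 1)); lia.
apply/imsetP; exists (Ordinal lt_i) => //.
apply/esym/eqP; rewrite eqEcard; apply/andP; split; last first.
  rewrite card_e (@sunflower_uniform m 1 r) //; apply/imsetP.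
  by exists (Ordinal lt_i).
apply/subsetP => u /setUP[]; last first.
  rewrite petalE /= subnKC // => /eqP eq_u.
  by suff -> : u = i by []; apply: val_inj.
rewrite inE => lt_u.
have /imsetP[v e_v /esym/eqP] : Some (Ordinal lt_u) \in colour @: e by rewrite ceT.
rewrite sunflower_colour_kernel => /eqP eq_v.
by suff -> : u = v by []; apply: val_inj; rewrite eq_v.
Qed.

Definition part_size (n : sunflower m 1 r -> nat) (k : option 'I_(r - 1)) :
    nat :=
  \sum_(i | colour i == k) n i.

Lemma part_size_kernel (n : sunflower m 1 r -> nat) (j : 'I_(r - 1)) :
  part_size n (Some j) = n (lshift (m * 1) j).
Proof.
by rewrite /part_size (big_pred1 (lshift (m * 1) j)) // => i;
   rewrite sunflower_colour_kernel.
Qed.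

Lemma part_size_petals (n : sunflower m 1 r -> nat) :
  part_size n None = \sum_(j in ~: kernel) n j.
Proof. by apply: eq_bigl => i; rewrite sunflower_colour_petal !inE. Qed.

Lemma sum_petals1 : \sum_(i | colour i == None) 1 = m.
Proof.
rewrite big_mkcond big_split_ord /= big1 ?add0n => [|j _]; last first.
  by rewrite sunflower_colour_petal inE /= ltn_ord.
rewrite (eq_bigr (fun=> 1)) ?sum1_card ?card_ord ?muln1 // => l _.
by rewrite sunflower_colour_petal inE /= ltnNge leq_addr.
Qed.

(** Exactly the part sizes realised by blow-ups of order [N]: the part [None] is a union of [m]
    non-empty blown-up petals. *)
Definition admissible (N : nat) (a : option 'I_(r - 1) -> nat) : Prop :=
  [/\ forall k, 0 < a k, \sum_k a k = N & m <= a None].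

Lemma part_size_admissible (N : nat) (n : sunflower m 1 r -> nat) :
  (forall i, 0 < n i) -> \sum_i n i = N -> admissible N (part_size n).
Proof.
move=> n_gt0 sum_n.
have ge_m : m <= part_size n None.
  by rewrite -sum_petals1; apply: leq_sum.
split=> //; last by rewrite -sum_n (partition_big colour predT).
case=> [j|]; first by rewrite part_size_kernel.
exact: leq_trans ge_m.
Qed.

Lemma part_size_surj (N : nat) (a : option 'I_(r - 1) -> nat) :
  admissible N a ->
  exists n, [/\ forall i, 0 < n i, \sum_i n i = N & part_size n =1 a].
Proof.
move=> [a_gt0 sum_a le_m].
(* The first petal, at index [r - 1], absorbs the surplus; the other [m.-1] petals keep one vertex
   each. *)
pose n (i : sunflower m 1 r) : nat :=
  if colour i is Some j then a (Some j)
  else if i == r - 1 :> nat then a None - m.-1 else 1.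
have partE : part_size n =1 a.
  case=> [j|].
    rewrite part_size_kernel /n.
    by have /eqP -> : colour (lshift (m * 1) j) == Some j
      by rewrite sunflower_colour_kernel.
  have lt0 : 0 < m * 1 by rewrite muln1.
  pose v : sunflower m 1 r := rshift (r - 1) (Ordinal lt0).
  have v_petal : colour v == None.
    by rewrite sunflower_colour_petal inE /= addn0 ltnn.
  have := sum_petals1; rewrite (bigD1 v) //= => sum1.
  rewrite /part_size (bigD1 v) //=.
  have -> : n v = a None - m.-1 by rewrite /n (eqP v_petal) /= addn0 eqxx.
  rewrite (eq_bigr (fun=> 1)).
    by move: sum1; set s := \sum_(i | _ && _) _; lia.
  move=> i /andP[/eqP ci iv]; rewrite /n ci; case: eqP => // eq_i.
  by case/eqP: iv; apply: val_inj; rewrite /= addn0.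
exists n; split=> //.
  move=> i; rewrite /n; case: (colour i) => [j|] //.
  by case: ifP => // _; rewrite subn_gt0 prednK.
rewrite -sum_a (partition_big colour predT) //=.
by apply: eq_bigr => k _; rewrite -partE.
Qed.

Lemma class_size_blowup_part (n : sunflower m 1 r -> nat) :
  class_size (fun w : blowup r n => colour (tag w)) =1 part_size n.
Proof. by move=> k; rewrite class_size_blowup. Qed.

Lemma rainbow_blowup_sunflower (n : sunflower m 1 r -> nat) :
  rainbow_colouring (fun w : blowup r n => colour (tag w)).
Proof. exact: (rainbow_blowup card_sunflower_colour rainbow_sunflower). Qed.

Lemma radius_blowup_leE (R : realType) (n n' : sunflower m 1 r -> nat) :
  1 < r -> (forall i, 0 < n i) -> (forall i, 0 < n' i) ->
  (spectral_radius R r (blowup r n) <= spectral_radius R r (blowup r n'))%R =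
  (\prod_k part_size n k <= \prod_k part_size n' k).
Proof.
move=> r_gt1 n_gt0 n'_gt0.
have size_gt0 (h : sunflower m 1 r -> nat) k : (forall i, 0 < h i) ->
    0 < class_size (fun w : blowup r h => colour (tag w)) k.
  move=> h_gt0; rewrite class_size_blowup_part.
  by have [] := part_size_admissible h_gt0 erefl.
rewrite (spectral_radius_leE _ _ card_sunflower_colour card_sunflower_colour
  (@rainbow_blowup_sunflower n) (@rainbow_blowup_sunflower n')) //;
  try by move=> k; apply: size_gt0.
by rewrite !(eq_bigr _ (fun k _ => class_size_blowup_part _ k)).
Qed.

(** * Extremal radii as extremal products *)

Section Extremal.
Variables (R : realType) (N : nat) (n : sunflower m 1 r -> nat).
Hypotheses (r_gt1 : 1 < r) (n_gt0 : forall i, 0 < n i) (sum_n : \sum_i n i = N).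

Lemma attains_min_radiusE :
  attains_min_radius R r N (sunflower m 1 r) (blowup r n) <->
  forall a, admissible N a -> \prod_k part_size n k <= \prod_k a k.
Proof.
split=> [[_ min_n] a /part_size_surj[n' [n'_gt0 sum_n' partE]]|min_n].
  rewrite -(eq_bigr _ (fun k _ => partE k)) -(radius_blowup_leE R) //.
  by apply: min_n; exists n'.
split; first by exists n.
move=> _ [n' [n'_gt0 sum_n' ->]]; rewrite radius_blowup_leE //.
exact/min_n/part_size_admissible.
Qed.

Lemma attains_max_radiusE :
  attains_max_radius R r N (sunflower m 1 r) (blowup r n) <->
  forall a, admissible N a -> \prod_k a k <= \prod_k part_size n k.
Proof.
split=> [[_ max_n] a /part_size_surj[n' [n'_gt0 sum_n' partE]]|max_n].
  rewrite -(eq_bigr _ (fun k _ => partE k)) -(radius_blowup_leE R) //.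
  by apply: max_n; exists n'.
split; first by exists n.
move=> _ [n' [n'_gt0 sum_n' ->]]; rewrite radius_blowup_leE //.
exact/max_n/part_size_admissible.
Qed.

End Extremal.
End Sunflower.

(** * Comparing sums and products of positive integers *)

(** Each new factor [a] on a product [p] uses [(a - 1) * (p - 1) >= 0], so positivity of the product
    is carried through the induction. *)
Lemma sum_le_prod (I : finType) (P : pred I) (a : I -> nat) :
  (forall i, 0 < a i) ->
  \sum_(i | P i) a i + 1 <= \prod_(i | P i) a i + #|P|.
Proof.
move=> a_gt0; rewrite -(sum1_card P).
suff [] : 0 < \prod_(i | P i) a i /\
  \sum_(i | P i) a i + 1 <= \prod_(i | P i) a i + \sum_(i | P i) 1 by [].
elim/big_rec3: _ => // i s p t _ [p_gt0 IH].
by have := a_gt0 i; split; nia.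
Qed.

(** With [i] split off, the remaining product [p] exceeds 1 because of [j], whence
    [(a i - 1) * (p - 1) > 0]. *)
Lemma sum_lt_prod (I : finType) (a : I -> nat) (i j : I) :
  (forall i, 0 < a i) -> i != j -> 1 < a i -> 1 < a j ->
  \sum_i a i + 1 < \prod_i a i + #|I|.
Proof.
move=> a_gt0 ij ai aj; rewrite (bigD1 i) //= [X in _ < X + _](bigD1 i) //=.
have := @sum_le_prod I (predC1 i) a a_gt0; have := cardC1 i.
have : 1 < \prod_(k | k != i) a k.
  rewrite (bigD1 j) 1?eq_sym //=.
  have : 0 < \prod_(k | (k != i) && (k != j)) a k by apply: prodn_gt0.
  nia.
have -> : #|predC1 i| = #|[pred k | k != i]| by [].
have : 0 < #|I| by apply/card_gt0P; exists i.
move: (\prod_(k | _) _) (\sum_(k | _) _) #|_| #|_| => p s t u.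
nia.
Qed.

(** Positivity of [b] excludes a vanishing right-hand side, where equality could hold for other
    reasons. *)
Lemma leqif_prod (I : finType) (C : pred I) (a b : I -> nat) :
  (forall i, 0 < b i) -> (forall i, a i <= b i ?= iff C i) ->
  \prod_i a i <= \prod_i b i ?= iff [forall i, C i].
Proof.
move=> b_gt0 le_ab.
have -> : [forall i, C i] = \big[andb/true]_i C i by rewrite big_andE.
suff [] : 0 < \prod_i b i /\
  \prod_i a i <= \prod_i b i ?= iff \big[andb/true]_i C i by [].
elim/big_rec3: _ => [|i c p q _ [p_gt0 IH]]; first by split=> //; exact/leqif_refl.
split; first by rewrite muln_gt0 b_gt0.
have := leqif_mul (le_ab i) IH.
by rewrite eqn0Ngt muln_gt0 b_gt0 p_gt0.
Qed.

(** * The chord inequality for the logarithm *)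

Definition near_quotient (q x : nat) : bool := (x == q) || (x == q.+1).

(* (x / y) (q / (q + 1)) ^ (x - y) <= 1, cleared of denominators *)
Definition chord_le (q x y : nat) (C : bool) : Prop :=
  x * (q.+1 ^ y * q ^ x) <= y * (q.+1 ^ x * q ^ y) ?= iff C.

(** Bernoulli: [(1 + 1/q)^d >= 1 + d/q >= 1 + d/y]. The first is strict from [d = 2] on, the second
    unless [d = 0] or [q = y]. *)
Lemma expn_succ_ge (q y d : nat) :
  0 < q -> q <= y ->
  (y + d) * q ^ d <= y * q.+1 ^ d ?= iff (d == 0) || (d == 1) && (q == y).
Proof.
move=> q_gt0 le_qy; apply/leqifP; elim: d => [|d IH]; first by rewrite /= addn0 !expn0.
have X_gt0 : 0 < q ^ d by rewrite expn_gt0 q_gt0.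
rewrite eqSS [d.+1 == 0]/= orFb !expnS.
have [d0|d_gt0] := posnP d.
  subst d; rewrite /= !expn0 !muln1; have [->|/eqP ne_qy] := eqVneq q y.
    by apply/eqP; nia.
  by nia.
case: d d_gt0 IH X_gt0 => [//|d] _ IH X_gt0 /=.
have le_IH : (y + d.+1) * q ^ d.+1 <= y * q.+1 ^ d.+1.
  by move: IH; case: ifP => [_ /eqP ->|_ /ltnW].
move: (q ^ d.+1) (q.+1 ^ d.+1) X_gt0 le_IH => X Y X_gt0 le_IH.
nia.
Qed.

(** The points to the left of [q]: [(1 - 1/(q + 1))^d >= 1 - d/(q + 1) > 1 - d/q]. *)
Lemma expn_succ_lt (q d : nat) :
  0 < d -> d <= q -> (q - d) * q.+1 ^ d < q * q ^ d.
Proof.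
elim: d => [//|d IH] _ lt_dq.
have X_gt0 : 0 < q.+1 ^ d by rewrite expn_gt0.
have le_IH : (q - d) * q.+1 ^ d <= q * q ^ d.
  case: d IH lt_dq X_gt0 => [|d] IH lt_dq _; first by rewrite subn0.
  by apply/ltnW/IH => //; apply: ltnW.
rewrite !expnS; move: X_gt0 le_IH; move: (q.+1 ^ d) (q ^ d) => X Y X_gt0 le_IH.
move: le_IH; have -> : q - d = (q - d.+1).+1 by lia.
have : q - d.+1 < q by lia.
by nia.
Qed.

Lemma leqif_scale (w a b a' b' : nat) (C : bool) :
  0 < w -> a' = w * a -> b' = w * b ->
  a <= b ?= iff C -> a' <= b' ?= iff C.
Proof.
by move=> w_gt0 -> -> [le_ab eq_ab]; split; rewrite ?leq_pmul2l ?eqn_pmul2l.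
Qed.

(** Beyond [y > q] the logarithm grows strictly slower than its chord between [q] and [q + 1], so a
    part bounded below by [y] is tight only at [y]. *)
Lemma chord_above (q y x : nat) :
  0 < q -> q < y -> y <= x -> chord_le q x y (x == y).
Proof.
move=> q_gt0 lt_qy /subnKC <-; move: (x - y) => d.
have := expn_succ_ge d q_gt0 (ltnW lt_qy).
rewrite (ltn_eqF lt_qy) andbF orbF => le_d.
have -> : (y + d == y) = (d == 0) by lia.
apply: (@leqif_scale (q.+1 ^ y * q ^ y)) le_d.
- by rewrite muln_gt0 !expn_gt0 q_gt0.
- by rewrite expnD; ring.
- by rewrite expnD; ring.
Qed.

Lemma chord_near (q y x : nat) :
  0 < q -> near_quotient q y -> chord_le q x y (near_quotient q x).
Proof.
move=> q_gt0.
have chord_q : chord_le q x q (near_quotient q x).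
  rewrite /near_quotient; have [le_qx|lt_xq] := leqP q x.
    move: le_qx => /subnKC <-; move: (x - q) => d.
    have -> : ((q + d == q) || (q + d == q.+1)) = (d == 0) || (d == 1) && (q == q).
      by rewrite eqxx andbT -{2}(addn0 q) -(addn1 q) !eqn_add2l.
    apply: (@leqif_scale (q.+1 ^ q * q ^ q)) (expn_succ_ge d q_gt0 (leqnn q)).
    - by rewrite muln_gt0 !expn_gt0 q_gt0.
    - by rewrite expnD; ring.
    - by rewrite expnD; ring.
  rewrite (ltn_eqF lt_xq) (ltn_eqF (leqW lt_xq)); apply/leqifP => /=.
  have [d d_gt0 qE] : exists2 d, 0 < d & q = x + d.
    by exists (q - x); rewrite ?subn_gt0 // subnKC // ltnW.
  have := @expn_succ_lt q d d_gt0; rewrite {1 2}qE leq_addl addnK => /(_ isT).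
  have W_gt0 : 0 < q.+1 ^ x * q ^ x by rewrite muln_gt0 !expn_gt0 q_gt0.
  rewrite -(ltn_pmul2l W_gt0).
  have powE z : z ^ q = z ^ x * z ^ d by rewrite qE expnD.
  rewrite !powE; congr (_ < _); ring.
(* Replacing [y = q] by [y = q.+1] multiplies both sides by [q.+1]. *)
case/orP => /eqP -> //.
by apply: (@leqif_scale q.+1) chord_q => //; rewrite !expnS; ring.
Qed.

(** Since [a] and [b] have equal sums, the powers of [q] and [q.+1] in the product of all chord
    inequalities agree on both sides and cancel. *)
Lemma prod_chord (I : finType) (q : nat) (a b : I -> nat) (C : pred I) :
  0 < q -> (forall i, 0 < b i) -> \sum_i a i = \sum_i b i ->
  (forall i, chord_le q (a i) (b i) (C i)) ->
  \prod_i a i <= \prod_i b i ?= iff [forall i, C i].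
Proof.
move=> q_gt0 b_gt0 sum_ab le_ab.
pose N := \sum_i b i.
have W_gt0 : 0 < q.+1 ^ N * q ^ N by rewrite muln_gt0 !expn_gt0 q_gt0.
have prodE (x y : I -> nat) : \sum_i x i = N -> \sum_i y i = N ->
    \prod_i (x i * (q.+1 ^ y i * q ^ x i)) = \prod_i x i * (q.+1 ^ N * q ^ N).
  by move=> sx sy; rewrite !big_split /= -!expn_sum sx sy.
have := leqif_prod _ le_ab.
rewrite !prodE // => /(_ _) [].
  by move=> i; rewrite !muln_gt0 !expn_gt0 q_gt0 b_gt0.
by rewrite leq_pmul2r // eqn_pmul2r.
Qed.

(** The sum is [q] times the number of terms plus the number of terms equal to [q.+1], so the sum
    and the number of terms fix the multiset of values. *)
Lemma near_quotient_class_size (I J : finType) (q : nat) (a : I -> nat) (b : J -> nat) :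
  #|I| = #|J| -> \sum_i a i = \sum_j b j ->
  (forall i, near_quotient q (a i)) -> (forall j, near_quotient q (b j)) ->
  class_size a =1 class_size b.
Proof.
move=> cIJ sum_ab near_a near_b.
have sumE (T : finType) (x : T -> nat) : (forall i, near_quotient q (x i)) ->
    [/\ \sum_i x i = q * #|T| + class_size x q.+1,
        #|T| = class_size x q + class_size x q.+1 &
        forall v, v != q -> v != q.+1 -> class_size x v = 0].
  move=> near_x; split.
  - rewrite /class_size -sum1_card [X in _ = X + _]mulnC -sum_nat_const.
    rewrite [X in _ = _ + X]big_mkcond -big_split /=; apply: eq_bigr => i _.
    rewrite inE; case/orP: (near_x i) => /eqP ->; last by rewrite eqxx addn1.
    by rewrite (ltn_eqF (ltnSn q)) addn0.
  - rewrite /class_size -!sum1_card [X in _ = X + _]big_mkcond.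
    rewrite [X in _ = _ + X]big_mkcond -big_split /=; apply: eq_bigr => i _.
    rewrite !inE; case/orP: (near_x i) => /eqP ->; rewrite eqxx.
      by rewrite (ltn_eqF (ltnSn q)).
    by rewrite (gtn_eqF (ltnSn q)).
  - move=> v /negPf vq /negPf vq1; apply/eqP; rewrite cards_eq0; apply/eqP/setP => i.
    by rewrite !inE; case/orP: (near_x i) => /eqP ->; rewrite eq_sym.
have [sa ca oa] := sumE I a near_a; have [sb cb ob] := sumE J b near_b.
move=> v; have [->|vq1] := eqVneq v q.+1; first by nia.
have [->|vq] := eqVneq v q; first by nia.
by rewrite oa ?ob.
Qed.

Lemma eq_class_size_prod (I J : finType) (a : I -> nat) (b : J -> nat) :
  class_size a =1 class_size b -> \prod_i a i = \prod_j b j.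
Proof.
move=> /class_size_eq_bij[f f_bij fE].
by rewrite (reindex f) /=; [apply: eq_bigr|exact: onW_bij].
Qed.

(** * The balanced complete hypergraph, coloured by residues *)

Section Balanced.
Variables (r N : nat).
Hypothesis r_gt0 : 0 < r.

Definition residue_colour (v : balanced_complete r N) : 'I_r :=
  Ordinal (ltn_pmod (v : 'I_N) r_gt0).

Lemma rainbow_residue : rainbow_colouring residue_colour.
Proof.
move=> e; rewrite inE card_ord; case: eqP => //= card_e.
have fibreE (j : 'I_r) : [set v : 'I_N in e | v %% r == j] =
    [set v in e | residue_colour v == j] by apply/setP => v; rewrite !inE.
rewrite -[X in _ == X]card_e; apply/forallP/imset_injP => [fib1 u v e_u e_v eq_uv|inj j].
  have /cards1P[w fibE] := fib1 (residue_colour v).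
  have : u \in [set w] by rewrite -fibE fibreE inE e_u eq_uv eqxx.
  have : v \in [set w] by rewrite -fibE fibreE inE e_v eqxx.
  by rewrite !inE => /eqP -> /eqP.
have : j \in residue_colour @: e.
  suff -> : residue_colour @: e = setT by rewrite inE.
  by apply/eqP; rewrite eqEcard subsetT cardsT card_ord card_in_imset // card_e /=.
case/imsetP => v e_v jE; apply/cards1P; exists v.
rewrite fibreE; apply/setP => u; rewrite !inE jE.
by apply/andP/eqP => [[e_u /eqP/inj->]|->].
Qed.

Lemma class_size_residue (j : 'I_r) :
  class_size residue_colour j = N %/ r + (j < N %% r).
Proof.
rewrite /class_size -sum1_card big_mkcond /=.
transitivity (\sum_(v < N) (v %% r == j : nat)).
  by apply: eq_bigr => v _; rewrite inE -val_eqE /=; case: eqP.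
elim: N => [|n IHn]; first by rewrite big_ord0 div0n mod0n.
rewrite big_ord_recr /= {}IHn; have lt_j := ltn_ord j.
have := divn_eq n r; have := ltn_pmod n r_gt0.
move: (n %/ r) (n %% r) => q s lt_s ->.
(* The new vertex has residue [s]; the remainder becomes [s.+1], or wraps round to 0 while the
   quotient grows. *)
have [lt_s1|ge_s1] := ltnP s.+1 r.
  rewrite -addnS divnMDl // modnMDl divn_small // modn_small // addn0.
  by rewrite ltnS; case: (ltngtP j s) => _; rewrite ?addn0.
have -> : (q * r + s).+1 = q.+1 * r + 0 by rewrite mulSn; lia.
rewrite divnMDl // modnMDl div0n mod0n !addn0.
have -> : s = r.-1 by lia.
by rewrite -(addn1 q) -addnA; congr (q + _); lia.
Qed.

Lemma near_class_size_residue (j : 'I_r) :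
  near_quotient (N %/ r) (class_size residue_colour j).
Proof.
rewrite class_size_residue /near_quotient.
by case: (j < _); rewrite ?addn0 ?addn1 eqxx ?orbT.
Qed.

Lemma sum_class_size_residue : \sum_j class_size residue_colour j = N.
Proof.
transitivity #|'I_N|; last exact: card_ord.
rewrite -sum1_card (partition_big residue_colour predT) //=.
by apply: eq_bigr => j _; rewrite /class_size -sum1_card;
   apply: eq_bigl => v; rewrite !inE.
Qed.

End Balanced.

Lemma big_option_sum (T : finType) (F : option T -> nat) :
  \sum_k F k = F None + \sum_j F (Some j).
Proof.
rewrite (bigD1 None) //=; congr (_ + _).
by rewrite (reindex_omap Some id) => [|[]] //; apply: eq_bigl => j; rewrite eqxx.
Qed.

Lemma big_option_prod (T : finType) (F : option T -> nat) :
  \prod_k F k = F None * \prod_j F (Some j).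
Proof.
rewrite (bigD1 None) //=; congr (_ * _).
by rewrite (reindex_omap Some id) => [|[]] //; apply: eq_bigl => j; rewrite eqxx.
Qed.

(** A spectral proof of a combinatorial fact: both products are read off the one radius of [H]. *)
Lemma eq_prod_class_size (R : realType) (r : nat) (H : hypergraph)
    (I J : finType) (c : H -> I) (d : H -> J) :
  1 < r -> #|I| = r -> #|J| = r ->
  rainbow_colouring c -> rainbow_colouring d ->
  (forall i, 0 < class_size c i) -> (forall j, 0 < class_size d j) ->
  \prod_i class_size c i = \prod_j class_size d j.
Proof.
move=> r_gt1 cI cJ colc cold c_gt0 d_gt0; apply/eqP.
rewrite eqn_leq -(spectral_radius_leE R r_gt1 cI cJ) //.
by rewrite -(spectral_radius_leE R r_gt1 cJ cI) // !lexx.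
Qed.

(** * Minimisers and automorphisms *)

Section Extremisers.
Variables (m r : nat).
Hypotheses (m_gt0 : 0 < m) (r_gt1 : 1 < r).
Let r_gt0 : 0 < r := ltnW r_gt1.
Notation colour := (@sunflower_colour m r).
Notation kernel := (sunflower_kernel m 1 r).

Lemma mem_kernel (j : 'I_(r - 1)) : lshift (m * 1) j \in kernel.
Proof. by rewrite inE /= ltn_ord. Qed.

Lemma kernelP (i : sunflower m 1 r) :
  i \in kernel -> exists j : 'I_(r - 1), i = lshift (m * 1) j.
Proof. by rewrite inE => lt_i; exists (Ordinal lt_i); apply: val_inj. Qed.

(** The blow-up by [n \o s] has two rainbow colourings, by the colour of the tag and by that of its
    image under [s], with the class sizes of [n \o s] and of [n]. *)
Lemma automorphism_prod (R : realType) (n : sunflower m 1 r -> nat)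
    (s : {perm sunflower m 1 r}) :
  (forall i, 0 < n i) -> automorphism s ->
  \prod_k part_size (n \o s) k = \prod_k part_size n k.
Proof.
move=> n_gt0 aut_s.
pose c (w : blowup r (n \o s)) := colour (tag w).
pose d (w : blowup r (n \o s)) := colour (s (tag w)).
have colc : rainbow_colouring c by apply: rainbow_blowup_sunflower.
have cold : rainbow_colouring d.
  have col_s := rainbow_colouring_comp aut_s (rainbow_sunflower m_gt0 r_gt0).
  exact: (@rainbow_blowup _ _ (n \o s) _ _ (card_sunflower_colour r_gt0) col_s).
have cE k : class_size c k = part_size (n \o s) k by rewrite class_size_blowup_part.
have dE k : class_size d k = part_size n k.
  rewrite (@class_size_blowup r _ (n \o s) _ (colour \o s)) /part_size.
  by rewrite [RHS](reindex_inj (@perm_inj _ s)).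
rewrite -(eq_bigr _ (fun k _ => cE k)) -(eq_bigr _ (fun k _ => dE k)).
have part_gt0 (h : sunflower m 1 r -> nat) k :
    (forall i, 0 < h i) -> 0 < part_size h k.
  by move=> h_gt0; have [] := part_size_admissible m_gt0 h_gt0 erefl.
have cardI := card_sunflower_colour r_gt0.
apply: (@eq_prod_class_size R r _ _ _ c d) => // k.
  by rewrite cE part_gt0 //= => i.
by rewrite dE part_gt0.
Qed.

Section Minimum.
Variables (R : realType) (N : nat) (n : sunflower m 1 r -> nat).
Hypotheses (n_gt0 : forall i, 0 < n i) (sum_n : \sum_i n i = N).

(** The least product is [N - (r - 1)], attained when all kernel parts are 1; [sum_le_prod] is the
    lower bound. *)
Lemma attains_min_radius_prod :
  attains_min_radius R r N (sunflower m 1 r) (blowup r n) <->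
  \prod_k part_size n k + r <= N + 1.
Proof.
have [part_gt0 sum_part le_m] := part_size_admissible m_gt0 n_gt0 sum_n.
rewrite attains_min_radiusE //; split=> [min_n|le_N a [a_gt0 sum_a _]].
  have ge_N : r - 1 + m <= N.
    rewrite -sum_part big_option_sum addnC leq_add //.
    rewrite -[X in X <= _]card_ord -sum1_card; exact: leq_sum.
  pose a (k : option 'I_(r - 1)) := if k is Some _ then 1 else N - (r - 1).
  have prod_a : \prod_k a k = N - (r - 1).
    by rewrite big_option_prod /= big1 // muln1.
  have : \prod_k part_size n k <= N - (r - 1).
    rewrite -prod_a; apply: min_n; split=> [[]//=||];
      rewrite ?big_option_sum /= ?sum1_card ?card_ord; lia.
  lia.
have := @sum_le_prod _ predT a a_gt0.
rewrite sum_a -[#|predT|]/#|{: option 'I_(r - 1)}| card_sunflower_colour // => le_a.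
by rewrite -(leq_add2r r); apply: leq_trans le_a.
Qed.

Lemma kernel1_prod :
  (forall i, i \in kernel -> n i = 1) ->
  \prod_k part_size n k + r <= N + 1 /\ \sum_(j in ~: kernel) n j = N - r + 1.
Proof.
move=> n1; have [part_gt0 sum_part le_m] := part_size_admissible m_gt0 n_gt0 sum_n.
have part1 j : part_size n (Some j) = 1 by rewrite part_size_kernel n1 ?mem_kernel.
rewrite -part_size_petals big_option_prod big1 // muln1 -sum_part big_option_sum.
rewrite (eq_bigr _ (fun j _ => part1 j)) sum1_card card_ord.
(* A non-empty petal part gives [N >= r], so the truncated [N - r + 1] is exact. *)
by move: (part_size n None) (leq_trans m_gt0 le_m) r_gt1 => p p_gt0 lt_r; lia.
Qed.

(** Two parts above 1 would make [sum_lt_prod] contradict minimality. *)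
Lemma min_prod_part1 (k l : option 'I_(r - 1)) :
  \prod_k part_size n k + r <= N + 1 -> k != l -> 1 < part_size n k ->
  part_size n l = 1.
Proof.
have [part_gt0 sum_part _] := part_size_admissible m_gt0 n_gt0 sum_n.
move=> le_N kl gt_k; apply/eqP; rewrite eqn_leq part_gt0 andbT leqNgt.
apply/negP => gt_l; have := sum_lt_prod part_gt0 kl gt_k gt_l.
by rewrite sum_part card_sunflower_colour //; lia.
Qed.

End Minimum.

Lemma automorphism1 : automorphism (1%g : {perm sunflower m 1 r}).
Proof.
split; first by exists id => x; rewrite perm1.
by move=> e; rewrite (eq_imset (g := id)) ?imset_id // => x; rewrite perm1.
Qed.

End Extremisers.

(** With one petal the colouring is injective, so being an edge depends on cardinality alone. *)
Lemma automorphism_single_edge (r : nat) (s : {perm sunflower 1 1 r}) :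
  0 < r -> automorphism s.
Proof.
move=> r_gt0; have col := @rainbow_sunflower 1 r isT r_gt0.
have c_inj : injective (@sunflower_colour 1 r).
  move=> i j eq_ij; case ci: (sunflower_colour i) (eq_ij) => [k|] cj.
    have /eqP -> : i == lshift _ k by rewrite -sunflower_colour_kernel ci.
    by apply/esym/eqP; rewrite -sunflower_colour_kernel -cj.
  have : i \notin sunflower_kernel 1 1 r by rewrite -sunflower_colour_petal ci.
  have : j \notin sunflower_kernel 1 1 r by rewrite -sunflower_colour_petal -cj.
  rewrite !inE => ge_j ge_i; apply: val_inj.
  have := ltn_ord (i : 'I_(r - 1 + 1 * 1)); have := ltn_ord (j : 'I_(r - 1 + 1 * 1)).
  by rewrite /=; lia.
split; first exact: injF_bij (@perm_inj _ s).
by move=> e; rewrite !col !(card_imset _ c_inj) card_imset //; apply: perm_inj.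
Qed.

(** * Maximisers *)

Section Maximum.
Variables (m r : nat).
Hypotheses (m_gt0 : 0 < m) (r_gt1 : 1 < r).
Let r_gt0 : 0 < r := ltnW r_gt1.
Variables (N : nat) (n : sunflower m 1 r -> nat).
Hypotheses (n_gt0 : forall i, 0 < n i) (sum_n : \sum_i n i = N).
Notation kernel := (sunflower_kernel m 1 r).

(** The candidate maximisers: [x] is [m] when [N < m * r], and [N %/ r] otherwise. *)
Definition split_parts (x q s : nat) (k : option 'I_(r - 1)) : nat :=
  if k is Some j then q + (j < s) else x.

Lemma sum_split_parts (x q s : nat) :
  s <= r - 1 -> \sum_k split_parts x q s k = x + (q * (r - 1) + s).
Proof.
move=> le_s; rewrite big_option_sum /= big_split /= sum_nat_const card_ord mulnC.
congr (_ + (_ + _)); rewrite -big_mkcond /=.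
by rewrite -(big_ord_widen_cond _ predT (fun=> 1)) // sum1_card card_ord.
Qed.

Lemma near_split_parts (x q s : nat) (j : 'I_(r - 1)) :
  near_quotient q (split_parts x q s (Some j)).
Proof. by rewrite /near_quotient /=; case: (j < s); rewrite ?addn0 ?addn1 eqxx ?orbT. Qed.

(** Common to both ranges of [N]: [b] is the candidate and [C] its tightness test. The second
    equivalence serves where only the product is known, as for an isomorphic copy. *)
Lemma attains_max_radius_leqif (R : realType) (q : nat)
    (b : option 'I_(r - 1) -> nat)
    (C : (option 'I_(r - 1) -> nat) -> pred (option 'I_(r - 1))) :
  0 < q -> admissible m N b ->
  (forall a k, admissible m N a -> chord_le q (a k) (b k) (C a k)) ->
  [/\ attains_max_radius R r N (sunflower m 1 r) (blowup r n) <->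
        forall k, C (part_size n) k &
      attains_max_radius R r N (sunflower m 1 r) (blowup r n) <->
        \prod_k part_size n k = \prod_k b k].
Proof.
move=> q_gt0 adm_b chord_b; have [b_gt0 sum_b _] := adm_b.
have le_b a : admissible m N a ->
    \prod_k a k <= \prod_k b k ?= iff [forall k, C a k].
  move=> adm_a; apply: (prod_chord q_gt0) => // [|k]; last exact: chord_b.
  by have [_ -> _] := adm_a.
have adm_n := part_size_admissible m_gt0 n_gt0 sum_n.
have [le_n eq_n] := le_b _ adm_n.
have maxE : attains_max_radius R r N (sunflower m 1 r) (blowup r n) <->
    \prod_k part_size n k = \prod_k b k.
  rewrite attains_max_radiusE //; split=> [max_n|-> a adm_a].
    by apply/eqP; rewrite eqn_leq le_n max_n.
  by have [] := le_b a adm_a.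
split=> //; rewrite maxE; split=> [eq_prod|C_n].
  by apply/forallP; rewrite -eq_n eq_prod.
by apply/eqP; rewrite eq_n; apply/forallP.
Qed.

Lemma part_size_petals1 :
  part_size n None = m <-> forall j, j \notin kernel -> n j = 1.
Proof.
have [_] := @leqif_sum (sunflower m 1 r) (fun i => sunflower_colour i == None)
  (fun i => 1 == n i) (fun=> 1) n (fun i _ => conj (n_gt0 i) erefl).
rewrite sum_petals1 => eq_m; split=> [part_m j|n1].
  rewrite -sunflower_colour_petal => j_petal.
  move/eqP: part_m; rewrite eq_sym eq_m => /forall_inP/(_ j j_petal).
  by rewrite eq_sym => /eqP.
apply/eqP; rewrite eq_sym eq_m; apply/forall_inP => i.
by rewrite sunflower_colour_petal => /n1 ->.
Qed.

Lemma ceil_divn_near (a b : nat) :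
  0 < b -> ceil_divn a b = a %/ b + (0 < a %% b).
Proof.
move=> b_gt0; rewrite /ceil_divn {1}(divn_eq a b) -addnA divnMDl //; congr (_ + _).
have := ltn_pmod a b_gt0; case: (a %% b) => [|s] lt_s; first by rewrite divn_small // prednK.
have -> : s.+1 + b.-1 = 1 * b + s by lia.
by rewrite divnMDl // divn_small // ltnW.
Qed.

(** The conditions differ only if [#|I|] divides [S], when floor and ceiling coincide; the sum then
    forces every term to equal the floor. *)
Lemma near_quotient_floor_ceil (I : finType) (a : I -> nat) (S : nat) :
  0 < #|I| -> \sum_i a i = S ->
  (forall i, near_quotient (S %/ #|I|) (a i)) <->
  (forall i, a i = S %/ #|I| \/ a i = ceil_divn S #|I|).
Proof.
move=> I_gt0 sum_a; rewrite (ceil_divn_near _ I_gt0); split=> near_a i; last first.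
  rewrite /near_quotient; case: (near_a i) => ->; rewrite ?eqxx //.
  by case: (0 < _); rewrite ?addn0 ?addn1 eqxx ?orbT.
have [S0|] := posnP (S %% #|I|); last first.
  by case/orP: (near_a i) => /eqP; [left|right; rewrite addn1].
left; have le_a j : S %/ #|I| <= a j by case/orP: (near_a j) => /eqP ->.
have [_] := @leqif_sum I predT (fun j => S %/ #|I| == a j) (fun=> S %/ #|I|) a
  (fun j _ => conj (le_a j) erefl).
rewrite sum_nat_const sum_a {2}(divn_eq S #|I|) S0 addn0 mulnC eqxx => /esym.
by move=> /forall_inP/(_ i isT)/eqP.
Qed.

Lemma attains_max_radius_small (R : realType) :
  N < m * r ->
  attains_max_radius R r N (sunflower m 1 r) (blowup r n) <->
  (forall i, i \in kernel ->
     n i = (N - m) %/ (r - 1) \/ n i = ceil_divn (N - m) (r - 1)) /\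
  (forall j, j \notin kernel -> n j = 1).
Proof.
move=> lt_N; have [part_gt0 sum_part le_m] := part_size_admissible m_gt0 n_gt0 sum_n.
have k_gt0 : 0 < r - 1 by rewrite subn_gt0.
pose q := (N - m) %/ (r - 1).
have ge_N : m + (r - 1) <= N.
  rewrite -sum_part big_option_sum leq_add // -[X in X <= _]card_ord -sum1_card.
  exact: leq_sum.
have q_gt0 : 0 < q by rewrite divn_gt0 //; lia.
(* Here [N < m * r] enters: the bound [m] on the petals lies above [q], so [chord_above] applies to
   the part [None]. *)
have lt_qm : q < m by rewrite ltn_divLR //; nia.
pose b := split_parts m q ((N - m) %% (r - 1)).
have adm_b : admissible m N b.
  split=> //.
    by case=> [j|] //=; rewrite addn_gt0 q_gt0.
  rewrite sum_split_parts; first by rewrite -divn_eq; lia.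
  exact/ltnW/ltn_pmod.
pose C (a : option 'I_(r - 1) -> nat) k :=
  if k is Some j then near_quotient q (a k) else a k == m.
have [|-> _] := @attains_max_radius_leqif R q b C q_gt0 adm_b.
  move=> a [j|] [a_gt0 sum_a le_a]; last exact: chord_above.
  by apply: chord_near => //; apply: near_split_parts.
have iff_near : part_size n None = m ->
    (forall j, near_quotient q (part_size n (Some j))) <->
    (forall j, part_size n (Some j) = q \/
               part_size n (Some j) = ceil_divn (N - m) (r - 1)).
  move=> part_m; have := @near_quotient_floor_ceil 'I_(r - 1)
    (fun j => part_size n (Some j)) (N - m).
  rewrite card_ord; apply=> //.
  by rewrite -sum_part big_option_sum part_m addKn.
split=> [C_n|[n_kernel /part_size_petals1 part_m]].
  have part_m : part_size n None = m by apply/eqP/(C_n None).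
  split; last exact/part_size_petals1.
  move=> i /kernelP[j ->]; rewrite -part_size_kernel.
  by apply: (iffLR (iff_near part_m)) => l; apply: (C_n (Some l)).
case=> [j|]; last exact/eqP.
apply: (iffRL (iff_near part_m)) => l.
by rewrite part_size_kernel; apply/n_kernel/mem_kernel.
Qed.

Lemma attains_max_radius_large (R : realType) :
  m * r <= N ->
  attains_max_radius R r N (sunflower m 1 r) (blowup r n) <->
  hisomorphic (blowup r n) (balanced_complete r N).
Proof.
move=> le_N; have [part_gt0 sum_part _] := part_size_admissible m_gt0 n_gt0 sum_n.
pose q := N %/ r; pose d := @residue_colour r N r_gt0.
(* Here [m * r <= N] enters: the balanced vector respects the bound on the petals. *)
have le_mq : m <= q by rewrite leq_divRL.
have q_gt0 : 0 < q := leq_trans m_gt0 le_mq.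
have cardI := card_sunflower_colour r_gt0.
pose b := split_parts q q (N %% r).
have near_b k : near_quotient q (b k).
  by case: k => [j|]; [apply: near_split_parts|rewrite /near_quotient eqxx].
have near_d j : near_quotient q (class_size d j) by apply: near_class_size_residue.
have near_gt0 x : near_quotient q x -> 0 < x by case/orP => /eqP ->.
have sum_b : \sum_k b k = N.
  rewrite sum_split_parts; last by have := ltn_pmod N r_gt0; lia.
  by rewrite [RHS](divn_eq N r) -/q; move: r_gt0; nia.
have adm_b : admissible m N b by split=> // k; apply: near_gt0.
have prod_b : \prod_k b k = \prod_j class_size d j.
  apply: eq_class_size_prod; apply: (near_quotient_class_size _ _ near_b near_d).
    by rewrite cardI card_ord.
  by rewrite sum_b sum_class_size_residue.
have [|maxC maxP] :=
    @attains_max_radius_leqif R q b (fun a k => near_quotient q (a k)) q_gt0 adm_b.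
  by move=> a k _; apply: chord_near.
split=> [/maxC near_n|[f f_iso]].
  have col_n := @rainbow_blowup_sunflower m r m_gt0 r_gt0 n.
  apply: (hisomorphic_rainbow col_n (@rainbow_residue r N r_gt0)) => v.
  transitivity (class_size (part_size n) v).
    by apply: eq_card => k; rewrite !inE class_size_blowup_part.
  apply: (near_quotient_class_size _ _ near_n near_d).
    by rewrite cardI card_ord.
  by rewrite sum_part sum_class_size_residue.
(* The residue colouring pulled back along [f] is a second rainbow colouring of the blow-up, so its
   product agrees with that of the parts. *)
apply/maxP; rewrite prod_b -(eq_bigr _ (fun k _ => class_size_blowup_part n k)).
have f_bij : bijective f by case: f_iso.
rewrite -(eq_bigr _ (fun j _ => class_size_comp d j f_bij)).
apply: (@eq_prod_class_size R r) => //; rewrite ?card_ord //.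
- exact: rainbow_blowup_sunflower.
- exact: rainbow_colouring_comp f_iso (rainbow_residue r_gt0).
- by move=> k; rewrite class_size_blowup_part.
- by move=> j; rewrite class_size_comp //; apply: near_gt0.
Qed.

End Maximum.

(** For [m = 1] the sunflower is a single edge with interchangeable vertices, and the large part of
    a minimiser may sit on a kernel vertex. Hence the minimum is described literally for [m >= 2],
    and up to an automorphism for all [m]. *)
Theorem theorem4p1 (R : realType) (r m N : nat) (hr : 2 <= r) (hm : 1 <= m)
    (n : sunflower m 1 r -> nat) (hn : forall i, 0 < n i)
    (hN : \sum_i n i = N) :
  [/\ (2 <= m ->
        (attains_min_radius R r N (sunflower m 1 r) (blowup r n) <->
         (forall i, i \in sunflower_kernel m 1 r -> n i = 1) /\
         \sum_(j in ~: sunflower_kernel m 1 r) n j = N - r + 1)),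
      (attains_min_radius R r N (sunflower m 1 r) (blowup r n) <->
       exists s : {perm sunflower m 1 r},
         [/\ automorphism s,
             forall i, i \in sunflower_kernel m 1 r -> n (s i) = 1 &
             \sum_(j in ~: sunflower_kernel m 1 r) n (s j) = N - r + 1]),
      (N < m * r ->
        (attains_max_radius R r N (sunflower m 1 r) (blowup r n) <->
         (forall i, i \in sunflower_kernel m 1 r ->
            n i = (N - m) %/ (r - 1) \/ n i = ceil_divn (N - m) (r - 1)) /\
         (forall j, j \notin sunflower_kernel m 1 r -> n j = 1))) &
      (m * r <= N ->
        (attains_max_radius R r N (sunflower m 1 r) (blowup r n) <->
         hisomorphic (blowup r n) (balanced_complete r N)))].
Proof.
have minP := attains_min_radius_prod hm hr R hn hN.
have [part_gt0 _ le_m] := part_size_admissible hm hn hN.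
have min_multi : 2 <= m ->
    (attains_min_radius R r N (sunflower m 1 r) (blowup r n) <->
     (forall i, i \in sunflower_kernel m 1 r -> n i = 1) /\
     \sum_(j in ~: sunflower_kernel m 1 r) n j = N - r + 1).
  move=> m_gt1; rewrite minP; split=> [le_prod|[n1 _]]; last first.
    by have [] := kernel1_prod hm hr hn hN n1.
  suff n1 : forall i, i \in sunflower_kernel m 1 r -> n i = 1.
    by split=> //; have [] := kernel1_prod hm hr hn hN n1.
  move=> i /kernelP[j ->]; rewrite -part_size_kernel.
  (* The petal part has at least [m >= 2] vertices, so it is the one part above 1. *)
  by apply: (min_prod_part1 hm hr hn hN (k := None)) => //; apply: leq_trans le_m.
have sum_perm (s : {perm sunflower m 1 r}) : \sum_i (n \o s) i = N.
  by rewrite -hN [RHS](reindex_inj (@perm_inj _ s)).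
have kernel_perm (s : {perm sunflower m 1 r}) :=
  @kernel1_prod m r hm hr N (n \o s) (fun i => hn (s i)) (sum_perm s).
split=> //; [|exact: attains_max_radius_small|exact: attains_max_radius_large].
split=> [min_n|[s [aut_s n1 _]]]; last first.
  by apply/minP; rewrite -(automorphism_prod hm hr R hn aut_s); have [] := kernel_perm s n1.
suff [s aut_s n1] : exists2 s : {perm sunflower m 1 r}, automorphism s &
    forall i, i \in sunflower_kernel m 1 r -> n (s i) = 1.
  by exists s; split=> //; have [] := kernel_perm s n1.
have [m_gt1|m_le1] := ltnP 1 m.
  exists 1%g; first exact: automorphism1.
  by have [n1 _] := iffLR (min_multi m_gt1) min_n; move=> i; rewrite perm1; apply: n1.
have m1 : m = 1 by apply/eqP; rewrite eqn_leq m_le1 hm.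
have aut_all (s : {perm sunflower m 1 r}) : automorphism s.
  by move: s; rewrite m1 => s; apply: automorphism_single_edge; apply: ltnW.
have [/forall_inP n1|] := boolP [forall i in sunflower_kernel m 1 r, n i == 1].
  by exists 1%g => // i; rewrite perm1 => /n1/eqP.
case/forall_inPn => i0 i0_ker n_i0.
have [j0 i0E] := kernelP i0_ker.
have lt0 : 0 < m * 1 by rewrite muln1.
pose v0 : sunflower m 1 r := rshift (r - 1) (Ordinal lt0).
have v0_petal : v0 \notin sunflower_kernel m 1 r by rewrite inE /= addn0 ltnn.
have part1 k : k != Some j0 -> part_size n k = 1.
  rewrite eq_sym => ne_k; apply: (min_prod_part1 hm hr hn hN _ ne_k); first exact/minP.
  by rewrite part_size_kernel -i0E ltn_neqAle eq_sym n_i0 hn.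
(* The only large part sits on the kernel vertex [i0]; swapping it with the petal [v0] moves it out
   of the kernel. *)
exists (tperm i0 v0) => // i i_ker.
have [->|ne_i] := eqVneq i i0.
  rewrite tpermL; apply/eqP; rewrite eqn_leq hn andbT -(part1 None) //.
  by rewrite /part_size (bigD1 v0) ?sunflower_colour_petal //= leq_addr.
rewrite tpermD 1?eq_sym //; last by apply: contraNneq v0_petal => <-.
have [j iE] := kernelP i_ker; rewrite iE -part_size_kernel part1 //.
by apply: contraNneq ne_i => -[eq_j]; rewrite iE i0E eq_j.
Qed.
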